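(* Assume: (consistency) $Y=Y(A)$; (latent ignorability) for any $a\in\mathcal{A}$, $Y(a)$ is conditionally independent of $\{A,Z\}$ given $(U,L)$; (IV independence) $Z$ is conditionally independent of $U$ given $L$; (IV relevance) for any $a\in\mathcal{A}$ and $l\in\mathcal{L}$, $Z$ and $I\{A=a\}$ are not conditionally independent given $L=l$, i.e. there exist two distinct $z_0,z_1\in\mathcal{Z}$ with $\Pr(A=a\mid Z=z_0,L=l)\neq\Pr(A=a\mid Z=z_1,L=l)$. Let $a\in\mathcal{A}$ and $A^{(a)}:=I\{A=a\}$. If $Z$ is an additive IV for $A=a$, then there exists a unique solution $f_a^o(A^{(a)},L)$ to $$\mathbb{E}[A^{(a)}Y\mid Z,L]=\mathbb{E}[f_a^o(A^{(a)},L)\mid Z,L],$$ given by $$f_a^o(0,L)=\mathrm{Cov}\{\mathbb{E}[Y(a)\mid U,L],\Pr(A=a\mid Z,U,L)\mid L\},$$ $$f_a^o(1,L)=\mathrm{Cov}\{\mathbb{E}[Y(a)\mid U,L],\Pr(A=a\mid Z,U,L)\mid L\}+\mathbb{E}[Y(a)\mid L].$$ Furthermore, if $\pi(Z,L)$ is a regular weighting function for $A=a$, then $$\mathbb{E}[Y(a)]=\mathbb{E}\left[\frac{\mathrm{Cov}\{A^{(a)}Y,\pi(Z,L)\mid L\}}{\mathrm{Cov}\{A^{(a)},\pi(Z,L)\mid L\}}\right].$$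
   Context: $A\in\mathcal{A}=\{0,\dots,M\}$ is a treatment, $Z\in\mathcal{Z}\subseteq\mathbb{R}^{d_Z}$ an instrument (multi-categorical or continuous), $U$ unmeasured confounders, $L\in\mathcal{L}\subseteq\mathbb{R}^{d_L}$ observed covariates, $Y\in\mathbb{R}$ the observed outcome, $Y(a)$ the potential outcome at treatment level $a$. $Z$ is an additive IV for $A=a$ if there exist functions $b(U,L)$, $c(Z,L)$ with $\Pr(A=a\mid Z,U,L)=b(U,L)+c(Z,L)$. $\pi(Z,L)$ is a regular weighting function for $A=a$ if it is uniformly bounded and there exists $\epsilon_0>0$ with $|\mathrm{Cov}\{I\{A=a\},\pi(Z,L)\mid L\}|\ge\epsilon_0$ uniformly for all $L$. Equalities between random variables are almost sure; the moments involved are assumed to exist. *)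

(* Defs.v *)
From HB Require Import structures.
From mathcomp Require Import all_boot all_order all_algebra.
From mathcomp Require Import all_classical all_reals all_analysis.

Set Implicit Arguments.
Unset Strict Implicit.
Unset Printing Implicit Defensive.

Import Order.TTheory GRing.Theory Num.Theory.
Import numFieldNormedType.Exports.

Local Open Scope classical_set_scope.
Local Open Scope ring_scope.

HB.instance Definition _ (n : nat) := isPointed.Build 'I_n.+1 ord0.

HB.instance Definition _ (n : nat) := @isMeasurable.Build
  default_measure_display 'I_n.+1 discrete_measurable discrete_measurable0
  discrete_measurableC discrete_measurableU.

Section conditioning.
Context {d d' : measure_display} {T : measurableType d}
  {T' : measurableType d'} {R : realType}.
Variable P : probability T R.

(* [h] is a version of the regression function [x |-> E[X | W = x]]: by the
   Doob-Dynkin lemma, being measurable for the sigma-algebra of [W] is the same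
   as factoring through [W]. *)
Definition is_cond_exp (X : T -> R) (W : T -> T') (h : T' -> R) : Prop :=
  [/\ measurable_fun [set: T'] h,
      P.-integrable [set: T] (EFin \o (h \o W)) &
      forall B, measurable B ->
        (\int[P]_(w in W @^-1` B) (h (W w))%:E =
         \int[P]_(w in W @^-1` B) (X w)%:E)%E].

(* The random variable E[X | W]: an arbitrary version, composed with [W]. It is
   the junk value 0 when there is no version, which does not happen for an
   integrable [X]. *)
Definition cond_exp (X : T -> R) (W : T -> T') : T -> R :=
  xget (cst 0) [set h | is_cond_exp X W h] \o W.

Definition cond_prob (E : set T) (W : T -> T') : T -> R := cond_exp (\1_E) W.

Definition cond_cov (X1 X2 : T -> R) (W : T -> T') : T -> R :=
  cond_exp (fun w => (X1 w - cond_exp X1 W w) * (X2 w - cond_exp X2 W w)) W.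

Definition cond_indep (d1 d2 : measure_display) (T1 : measurableType d1)
    (T2 : measurableType d2) (X1 : T -> T1) (X2 : T -> T2) (W : T -> T') :
    Prop :=
  forall B1 B2, measurable B1 -> measurable B2 ->
    {ae P, forall w, cond_prob (X1 @^-1` B1 `&` X2 @^-1` B2) W w =
      cond_prob (X1 @^-1` B1) W w * cond_prob (X2 @^-1` B2) W w}.

End conditioning.

Section instrumental_variable.
Context {d dU : measure_display} {T : measurableType d}
  {TU : measurableType dU} {R : realType}.
Variables (P : probability T R) (M dZ dL : nat).
Implicit Types (A : T -> 'I_M.+1) (Z : T -> dZ.-tuple R) (U : T -> TU).
Implicit Types (L : T -> dL.-tuple R) (Y : T -> R) (Ypot : 'I_M.+1 -> T -> R).
Implicit Types (SZ : set (dZ.-tuple R)) (SL : set (dL.-tuple R)).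
Implicit Types (a : 'I_M.+1) (pi : dZ.-tuple R -> dL.-tuple R -> R).

Definition trt A a : T -> bool := fun w => A w == a.

Definition trtR A a : T -> R := fun w => (trt A a w)%:R.

Definition consistency A Y Ypot : Prop := {ae P, forall w, Y w = Ypot (A w) w}.

Definition latent_ignorability A Z U L Ypot : Prop :=
  forall a, cond_indep P (Ypot a) (fun w => (A w, Z w)) (fun w => (U w, L w)).

Definition iv_independence Z U L : Prop := cond_indep P Z U L.

(* Pr(A = a | Z = z, L = l) is only determined up to a null set of (z, l), so
   the pointwise condition is required of every version [p], for almost every
   [l]. Quantifying over all versions makes this say exactly that, for almost
   every [l], A^(a) and Z are not conditionally independent given L = l:
   if [p(., l)] were almost surely constant for a non-negligible measurable set
   of [l], redefining [p] there by that constant would give another version. *)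
Definition iv_relevance SZ SL A Z L : Prop :=
  forall a (p : dZ.-tuple R * dL.-tuple R -> R),
    is_cond_exp P (\1_[set w | A w = a]) (fun w => (Z w, L w)) p ->
    {ae pushforward P L, forall l, SL l ->
      exists z0 z1, [/\ SZ z0, SZ z1, z0 <> z1 & p (z0, l) <> p (z1, l)]}.

(* Pr(A = a | Z, U, L) *)
Definition latent_propensity A Z U L a : T -> R :=
  cond_prob P [set w | A w = a] (fun w => (Z w, U w, L w)).

Definition additive_iv A Z U L a : Prop :=
  exists (b : TU * dL.-tuple R -> R) (c : dZ.-tuple R * dL.-tuple R -> R),
    [/\ measurable_fun setT b, measurable_fun setT c &
        {ae P, forall w, latent_propensity A Z U L a w =
          b (U w, L w) + c (Z w, L w)}].

Definition regular_weighting SZ SL A Z L a pi : Prop :=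
  [/\ measurable_fun [set: dZ.-tuple R * dL.-tuple R]
        (fun zl => pi zl.1 zl.2),
      exists C : R, forall z l, SZ z -> SL l -> `|pi z l| <= C &
      exists2 eps0 : R, 0 < eps0 &
        {ae P, forall w, eps0 <=
          `|cond_cov P (trtR A a) (fun w => pi (Z w) (L w)) L w|}].

(* [f] solves E[A^(a) Y | Z, L] = E[f(A^(a), L) | Z, L]; the value [true] of the
   first argument stands for A^(a) = 1. *)
Definition solves_bridge A Z L Y a (f : bool -> dL.-tuple R -> R) : Prop :=
  [/\ forall i, measurable_fun setT (f i),
      P.-integrable setT (EFin \o (fun w => f (trt A a w) (L w))) &
      {ae P, forall w,
        cond_exp P (fun w => trtR A a w * Y w) (fun w => (Z w, L w)) w =
        cond_exp P (fun w => f (trt A a w) (L w)) (fun w => (Z w, L w)) w}].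

(* Cov{E[Y(a) | U, L], Pr(A = a | Z, U, L) | L} *)
Definition confounding_cov A Z U L Ypot a : T -> R :=
  cond_cov P (cond_exp P (Ypot a) (fun w => (U w, L w)))
    (latent_propensity A Z U L a) L.

End instrumental_variable.

(* Main.v *)
(** Write p = Pr(A = a | Z,U,L), m = E[Y(a) | U,L], mu = E[Y(a) | L], and let
    beta, gamma, delta be the projections of p on (U,L), (Z,L), L.  Additivity
    and Z _|_ U | L give p = beta + gamma - delta: the residual
    r = p - beta - gamma + delta is orthogonal to every bounded function of
    (Z,L) and of (U,L), and is itself a sum of two such functions (on the
    sigma(L)-events where b and c are bounded).  Hence
    p - gamma is a function of (U,L), so that, given (Z,L),
      E[A^(a) Y | Z,L] = E[m p | Z,L] = kappa + mu gamma,
    with kappa = Cov(m, p | L).  This is the bridge equation.  For two solutions,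
    the difference g satisfies g(0,L) + (g(1,L) - g(0,L)) gamma = 0; wherever
    g(1,l) <> g(0,l), gamma has a version constant in z, against relevance.
    Multiplying the bridge equation by pi - E[pi | L] gives
    Cov(A^(a) Y, pi | L) = mu Cov(A^(a), pi | L). *)
Require Import Defs.
From HB Require Import structures.
From mathcomp Require Import all_boot all_order all_algebra.
From mathcomp Require Import ring lra.
From mathcomp Require Import all_classical all_reals all_analysis.
From mathcomp Require Import measurable_realfun.

Set Implicit Arguments.
Unset Strict Implicit.
Unset Printing Implicit Defensive.

Import Order.TTheory GRing.Theory Num.Theory.
Import numFieldNormedType.Exports.

Local Open Scope classical_set_scope.
Local Open Scope ring_scope.

(** * Integrable and almost surely bounded functions *)

Section integrability.
Context {d : measure_display} {T : measurableType d} {R : realType}.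
Variable P : probability T R.
Implicit Types f g : T -> R.

Definition itg f := P.-integrable [set: T] (EFin \o f).

(** The bound is only almost sure because a version of the conditional expectation of a bounded
    variable inherits it in that form. *)
Definition ae_bounded f :=
  measurable_fun [set: T] f /\ exists C : R, {ae P, forall w, `|f w| <= C}.

Lemma itg_measurable f : itg f -> measurable_fun [set: T] f.
Proof. by move=> /measurable_int /measurable_EFinP. Qed.

Lemma itgD f g : itg f -> itg g -> itg (fun w => f w + g w).
Proof. by move=> fi gi; exact: (integrableD measurableT fi gi). Qed.

Lemma itgB f g : itg f -> itg g -> itg (fun w => f w - g w).
Proof. by move=> fi gi; exact: (integrableB measurableT fi gi). Qed.

Lemma itg_ae f g : itg f -> measurable_fun [set: T] g ->
  {ae P, forall w, g w = f w} -> itg g.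
Proof.
move=> /integrableP[mf fi] mg fg; apply/integrableP; split.
  exact/measurable_EFinP.
apply: le_lt_trans fi; apply: ae_ge0_le_integral => //.
- by apply: measurableT_comp => //; exact/measurable_EFinP.
- exact: measurableT_comp.
- by apply: filterS fg => w /= gf _; rewrite gf.
Qed.

Lemma itg_le f g : itg f -> measurable_fun [set: T] g ->
  {ae P, forall w, `|g w| <= `|f w|} -> itg g.
Proof.
move=> /integrableP[mf fi] mg fg; apply/integrableP; split.
  exact/measurable_EFinP.
apply: le_lt_trans fi; apply: ae_ge0_le_integral => //.
- by apply: measurableT_comp => //; exact/measurable_EFinP.
- exact: measurableT_comp.
- by apply: filterS fg => w /= gf _; rewrite lee_fin.
Qed.

Lemma itg_cst (C : R) : itg (fun=> C).
Proof. exact: finite_measure_integrable_cst. Qed.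

Lemma itg_ae_bounded f : ae_bounded f -> itg f.
Proof.
move=> [mf [C fC]]; apply: itg_le (itg_cst C) mf _.
by apply: filterS fC => w /le_trans; apply; exact: ler_norm.
Qed.

Lemma itgM f g : ae_bounded f -> itg g -> itg (fun w => f w * g w).
Proof.
move=> [mf [C fC]] gi.
have Cgi : itg (fun w => C * g w) by exact: (integrableZl measurableT C gi).
apply: itg_le Cgi _ _.
  by apply: measurable_funM => //; exact: itg_measurable.
apply: filterS fC => w fC; rewrite !normrM ler_wpM2r//.
exact: le_trans fC (ler_norm _).
Qed.

Lemma itgMr f g : itg f -> ae_bounded g -> itg (fun w => f w * g w).
Proof.
move=> fi gb; under [fun w => _]funext do rewrite mulrC.
exact: itgM.
Qed.

Lemma ae_boundedD f g : ae_bounded f -> ae_bounded g ->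
  ae_bounded (fun w => f w + g w).
Proof.
move=> [mf [C fC]] [mg [D gD]]; split; first exact: measurable_funD.
exists (C + D); apply: filterS2 fC gD => w fC gD.
by rewrite (le_trans (ler_normD _ _))// lerD.
Qed.

Lemma ae_boundedB f g : ae_bounded f -> ae_bounded g ->
  ae_bounded (fun w => f w - g w).
Proof.
move=> [mf [C fC]] [mg [D gD]]; split; first exact: measurable_funB.
exists (C + D); apply: filterS2 fC gD => w fC gD.
by rewrite (le_trans (ler_normB _ _))// lerD.
Qed.

Lemma ae_boundedM f g : ae_bounded f -> ae_bounded g ->
  ae_bounded (fun w => f w * g w).
Proof.
move=> [mf [C fC]] [mg [D gD]]; split; first exact: measurable_funM.
exists (C * D); apply: filterS2 fC gD => w fC gD.
by rewrite normrM ler_pM.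
Qed.

Lemma ae_bounded_indic A : measurable A -> ae_bounded (\1_A).
Proof.
move=> mA; split; first exact: measurable_indic.
exists 1; apply: aeW => w; rewrite indicE.
by case: (w \in A); rewrite ?normr1 ?normr0.
Qed.

Lemma integral_set_indic A f : measurable A ->
  (\int[P]_(w in A) (f w)%:E = \int[P]_w (\1_A w * f w)%:E)%E.
Proof.
move=> mA; rewrite integral_mkcond; apply: eq_integral => w _.
by rewrite patchE indicE; case: (w \in A); rewrite /= ?mul1r ?mul0r.
Qed.

End integrability.

Lemma measurable_preimageT {d d' : measure_display} {T : measurableType d}
    {T' : measurableType d'} (f : T -> T') B :
  measurable_fun [set: T] f -> measurable B -> measurable (f @^-1` B).
Proof. by move=> mf mB; rewrite -[X in measurable X]setTI; exact: mf. Qed.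

(** * Conditionally centered variables and multiplication by functions of the conditioner *)

Section centered.
Context {d d' : measure_display} {T : measurableType d}
  {T' : measurableType d'} {R : realType}.
Variable P : probability T R.
Implicit Types (D : T -> R) (W : T -> T').

(* E[D | W] = 0 almost surely, stated without choosing a version. *)
Definition cond_centered D W : Prop := itg P D /\
  forall B, measurable B -> (\int[P]_(w in W @^-1` B) (D w)%:E = 0)%E.

Lemma cond_centered0 W : cond_centered (fun=> 0) W.
Proof. by split=> [|B mB]; [exact: itg_cst|rewrite integral0]. Qed.

Lemma cond_centered_integral D W : cond_centered D W ->
  (\int[P]_w (D w)%:E = 0)%E.
Proof. by move=> [_ /(_ _ measurableT)]; rewrite preimage_setT. Qed.

Lemma cond_centeredD D1 D2 W : measurable_fun [set: T] W ->
  cond_centered D1 W -> cond_centered D2 W ->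
  cond_centered (fun w => D1 w + D2 w) W.
Proof.
move=> mW [i1 c1] [i2 c2]; split; first exact: itgD.
move=> B mB; have mWB := measurable_preimageT mW mB.
under eq_integral do rewrite EFinD.
by rewrite integralD ?c1 ?c2 ?adde0//; apply: (integrableS measurableT).
Qed.

Lemma cond_centeredB D1 D2 W : measurable_fun [set: T] W ->
  cond_centered D1 W -> cond_centered D2 W ->
  cond_centered (fun w => D1 w - D2 w) W.
Proof.
move=> mW [i1 c1] [i2 c2]; split; first exact: itgB.
move=> B mB; have mWB := measurable_preimageT mW mB.
under eq_integral do rewrite EFinB.
by rewrite integralB ?c1 ?c2 ?sube0//; apply: (integrableS measurableT).
Qed.

Lemma cond_centered_ae D1 D2 W : measurable_fun [set: T] W ->
  measurable_fun [set: T] D2 -> {ae P, forall w, D2 w = D1 w} ->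
  cond_centered D1 W -> cond_centered D2 W.
Proof.
move=> mW m2 e12 [i1 c1]; split; first exact: itg_ae e12.
move=> B mB; rewrite -(c1 _ mB).
have mWB := measurable_preimageT mW mB.
apply: ae_eq_integral => //.
- by apply/measurable_EFinP; exact: measurable_funTS.
- by apply/measurable_EFinP; apply: measurable_funTS; exact: itg_measurable i1.
- by apply: filterS e12 => w -> _.
Qed.

Lemma cond_centered_ext D1 D2 W : D1 =1 D2 -> cond_centered D1 W ->
  cond_centered D2 W.
Proof. by move=> /funext ->. Qed.

Import HBNNSimple.

(** A simple function is a finite combination of indicators of its level sets, and [D] integrates to
    0 over the preimage of each of them under [W]. *)
Let integral_nnsfun_centered D W (s : {nnsfun T' >-> R}) :
  measurable_fun [set: T] W -> cond_centered D W ->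
  (\int[P]_w (s (W w) * D w)%:E = 0)%E.
Proof.
move=> mW [iD cD].
pose F (y : R) (w : T) := (y%:E * (\1_(s @^-1` [set y]) (W w) * D w)%:E)%E.
have mF y : measurable (W @^-1` (s @^-1` [set y])).
  by apply: measurable_preimageT => //; exact: measurable_funPTI.
have iF y : itg P (fun w => \1_(s @^-1` [set y]) (W w) * D w).
  exact: (itgM (ae_bounded_indic P (mF y)) iD).
under eq_integral => w _.
  rewrite fimfunE fsbig_finite// mulr_suml -sumEFin.
  under eq_bigr do rewrite -mulrA EFinM.
  over.
rewrite (@integral_sum _ _ _ P setT measurableT _ F)//; last first.
  by move=> y; apply: (integrableZl measurableT); exact: iF.
rewrite big1// => y _; rewrite /F integralZl//; last exact: iF.
rewrite -(integral_set_indic P D (mF y)) cD ?mule0//.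
Qed.

(** Dominated convergence along simple functions [s n] below [phi]; the dominating function is
    |phi(W) D| itself, integrable by assumption. *)
Let integral_ge0_centered D W (phi : T' -> R) :
  measurable_fun [set: T] W -> measurable_fun [set: T'] phi ->
  (forall x, 0 <= phi x) -> cond_centered D W ->
  itg P (fun w => phi (W w) * D w) -> (\int[P]_w (phi (W w) * D w)%:E = 0)%E.
Proof.
move=> mW mphi phi0 cD ipD.
have mD := itg_measurable cD.1.
have mphi' : measurable_fun [set: T'] (EFin \o phi) by exact/measurable_EFinP.
pose s := nnsfun_approx measurableT mphi'.
have sphi x : (s n x)%:E @[n --> \oo] --> (phi x)%:E.
  by apply: (cvg_nnsfun_approx measurableT mphi') => // y _; rewrite lee_fin.
have sle n x : s n x <= phi x.
  rewrite -lee_fin /s nnsfun_approxE; apply: le_approx => //= y _.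
  by rewrite lee_fin.
have [|||||_ _ h] := @dominated_convergence _ _ _ P setT measurableT
  (fun n w => (s n (W w) * D w)%:E) (fun w => (phi (W w) * D w)%:E)
  (fun w => `|(phi (W w) * D w)%:E|%E).
- move=> n; apply/measurable_EFinP; apply: measurable_funM => //.
  by apply: measurableT_comp => //; exact: measurable_funPT.
- exact: measurable_int ipD.
- apply: aeW => w _; under eq_fun do rewrite EFinM.
  by rewrite EFinM; apply: cvgeZr => //; exact: sphi.
- exact: (integrable_abse ipD).
- apply: aeW => w n _; rewrite lee_fin !normrM ler_wpM2r//.
  by rewrite !ger0_norm.
apply/esym; apply: cvg_unique h => //.
rewrite (_ : [sequence _]_n = cst 0%E); first exact: cvg_cst.
by apply/funext => n; exact: integral_nnsfun_centered.
Qed.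

(** The positive and negative parts of [phi] are both dominated by |phi|, so integrability of the
    product passes to each part. An unbounded [phi] is thus allowed as soon as phi(W) D is
    integrable. *)
Lemma integral_centeredM D W (phi : T' -> R) :
  measurable_fun [set: T] W -> measurable_fun [set: T'] phi ->
  cond_centered D W ->
  itg P (fun w => phi (W w) * D w) -> (\int[P]_w (phi (W w) * D w)%:E = 0)%E.
Proof.
move=> mW mphi cD ipD; have mD := itg_measurable cD.1.
have mp := measurable_funrpos mphi; have mn := measurable_funrneg mphi.
have ip : itg P (fun w => phi^\+ (W w) * D w).
  apply: itg_le ipD _ _.
    by apply: measurable_funM => //; exact: measurableT_comp.
  apply: aeW => w; rewrite !normrM ler_wpM2r//.
  by rewrite /funrpos /=; case: (leP (phi (W w)) 0); rewrite ?normr0.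
have in_ : itg P (fun w => phi^\- (W w) * D w).
  apply: itg_le ipD _ _.
    by apply: measurable_funM => //; exact: measurableT_comp.
  apply: aeW => w; rewrite !normrM ler_wpM2r//.
  by rewrite /funrneg /=; case: (leP (- phi (W w)) 0); rewrite ?normrN ?normr0.
under eq_integral => w _.
  rewrite (_ : phi (W w) = phi^\+ (W w) - phi^\- (W w)); last first.
    rewrite /funrpos /funrneg /=.
    by case: (leP (phi (W w)) 0) (leP (- phi (W w)) 0) => ? []; lra.
  rewrite mulrBl EFinB; over.
rewrite integralB//.
by rewrite !integral_ge0_centered ?sube0// => x; rewrite ?funrpos_ge0 ?funrneg_ge0.
Qed.

(** Taking out what is known: the indicator of [B] is absorbed into the multiplier [phi]. *)
Lemma cond_centeredM D W (phi : T' -> R) :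
  measurable_fun [set: T] W -> measurable_fun [set: T'] phi ->
  itg P (fun w => phi (W w) * D w) -> cond_centered D W ->
  cond_centered (fun w => phi (W w) * D w) W.
Proof.
move=> mW mphi ipD cD; split=> // B mB.
have mWB := measurable_preimageT mW mB.
rewrite integral_set_indic//.
under eq_integral do rewrite mulrA.
have := @integral_centeredM D W (fun x => \1_B x * phi x) mW _ cD; apply.
  by apply: measurable_funM => //; exact: measurable_indic.
rewrite -[X in itg P X]/(fun w => \1_(W @^-1` B) w * phi (W w) * D w).
under [fun w => _]funext do rewrite -mulrA.
by apply: itgM => //; exact: ae_bounded_indic.
Qed.

End centered.

Lemma integral_eq0_ae {d : measure_display} {T : measurableType d}
    {R : realType} (P : probability T R) (B : set T) (f : T -> R) :
  measurable B -> itg P f -> {ae P, forall w, B w -> 0 <= f w} ->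
  (\int[P]_(w in B) (f w)%:E = 0)%E -> {ae P, forall w, B w -> f w = 0}.
Proof.
move=> mB iF f0 if0.
have mf : measurable_fun B (EFin \o f).
  by apply/measurable_EFinP/measurable_funTS; exact: itg_measurable iF.
have /(ae_eq_integral_abs _ mB mf) : (\int[P]_(w in B) `|(f w)%:E| = 0)%E.
  rewrite -if0; apply: ae_eq_integral => //; first exact: measurableT_comp.
  by apply: filterS f0 => w f0 /f0 ?; rewrite abse_EFin ger0_norm.
by apply: filterS => w /= h /h [].
Qed.

(** * Versions of conditional expectations: order, uniqueness, existence *)

Section conditional_expectation.
Context {d d' : measure_display} {T : measurableType d}
  {T' : measurableType d'} {R : realType}.
Variable P : probability T R.
Implicit Types (X D : T -> R) (W : T -> T') (h : T' -> R).

(** On the event h(W) < 0 the difference D - h(W) is almost surely positive, yet it integrates to 0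
    there; hence the event is null. *)
Lemma cond_centered_ge0 h D W : measurable_fun [set: T] W ->
  measurable_fun [set: T'] h ->
  cond_centered P (fun w => D w - h (W w)) W ->
  measurable_fun [set: T] D ->
  {ae P, forall w, 0 <= D w} -> {ae P, forall w, 0 <= h (W w)}.
Proof.
move=> mW mh [iDh cDh] mD D0.
pose B := [set x | h x < 0].
have mB : measurable B.
  rewrite (_ : B = h @^-1` `]-oo, 0[%classic); first exact: measurable_preimageT.
  by apply/seteqP; split=> x; rewrite /B /= in_itv.
have mWB := measurable_preimageT mW mB.
have : {ae P, forall w, (W @^-1` B) w -> D w - h (W w) = 0}.
  apply: integral_eq0_ae => //; last exact: cDh.
  by apply: filterS D0 => w D0; rewrite /B /=; lra.
by apply: filterS2 D0 => w D0 h0; rewrite leNgt; apply/negP => hW;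
  move: (h0 hW); lra.
Qed.

(** Positivity is applied to [h] and to its opposite, both compared with the zero variable. This is
    the source of almost sure uniqueness of versions. *)
Lemma cond_centered_id h W : measurable_fun [set: T] W ->
  measurable_fun [set: T'] h ->
  cond_centered P (fun w => h (W w)) W -> {ae P, forall w, h (W w) = 0}.
Proof.
move=> mW mh ch.
have c0 := cond_centered0 P W.
have mhN : measurable_fun [set: T'] (fun x => - h x) by exact: measurable_funN.
have hN : {ae P, forall w, 0 <= - h (W w)}.
  apply: (@cond_centered_ge0 (fun x => - h x) (fun=> 0)) => //.
    by apply: cond_centered_ext ch => w; rewrite sub0r opprK.
  by apply: aeW => w.
have hP : {ae P, forall w, 0 <= h (W w)}.
  apply: (@cond_centered_ge0 h (fun=> 0)) => //; last exact: aeW.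
  exact: cond_centeredB.
by apply: filterS2 hN hP => w /=; lra.
Qed.

(** Positivity applied to C - D and C + D transfers the bound C from [D] to its projection. *)
Lemma cond_centered_bounded h D W : measurable_fun [set: T] W ->
  measurable_fun [set: T'] h ->
  cond_centered P (fun w => D w - h (W w)) W ->
  ae_bounded P D -> ae_bounded P (h \o W).
Proof.
move=> mW mh ch [mD [C DC]]; split; first exact: measurableT_comp.
exists C.
have c0 := cond_centered0 P W.
have hN : {ae P, forall w, 0 <= C - h (W w)}.
  apply: (@cond_centered_ge0 (fun x => C - h x) (fun w => C - D w)) => //.
  - exact: measurable_funB.
  - apply: (cond_centered_ext _ (cond_centeredB mW c0 ch)) => w /=; lra.
  - exact: measurable_funB.
  - by apply: filterS DC => w; rewrite ler_norml; lra.
have hP : {ae P, forall w, 0 <= C + h (W w)}.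
  apply: (@cond_centered_ge0 (fun x => C + h x) (fun w => C + D w)) => //.
  - exact: measurable_funD.
  - apply: (cond_centered_ext _ ch) => w /=; lra.
  - exact: measurable_funD.
  - by apply: filterS DC => w; rewrite ler_norml; lra.
by apply: filterS2 hN hP => w h1 h2 /=; rewrite ler_norml; lra.
Qed.

(** Tower property: every event of [psi \o W] is an event of [W]. *)
Lemma cond_centered_comp {d2} {T2 : measurableType d2} (psi : T' -> T2) D W :
  measurable_fun [set: T'] psi -> cond_centered P D W ->
  cond_centered P D (psi \o W).
Proof.
move=> mpsi [iD cD]; split=> // B mB; rewrite comp_preimage; apply: cD.
exact: measurable_preimageT.
Qed.

Lemma is_cond_exp_centered X W h : measurable_fun [set: T] W -> itg P X ->
  is_cond_exp P X W h ->
  itg P (h \o W) /\ cond_centered P (fun w => X w - h (W w)) W.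
Proof.
move=> mW iX [mh ih eh]; split=> //; split; first exact: itgB.
move=> B mB; have mWB := measurable_preimageT mW mB.
under eq_integral do rewrite EFinB.
rewrite integralB//; [|exact: (integrableS measurableT)..].
rewrite eh// subee//; apply: integrable_fin_num => //.
exact: (integrableS measurableT).
Qed.

Lemma centered_is_cond_exp X W h : measurable_fun [set: T] W -> itg P X ->
  measurable_fun [set: T'] h -> itg P (h \o W) ->
  cond_centered P (fun w => X w - h (W w)) W -> is_cond_exp P X W h.
Proof.
move=> mW iX mh ih [_ ch]; split=> // B mB.
have mWB := measurable_preimageT mW mB.
have := ch _ mB; under eq_integral do rewrite EFinB.
have iX' := integrableS measurableT mWB (@subsetT _ _) iX.
have ih' := integrableS measurableT mWB (@subsetT _ _) ih.
rewrite integralB//.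
by move/eqP; rewrite sube_eq ?add0e ?integrable_fin_num ?fin_num_adde_defr// => /eqP.
Qed.

(** The charge X dP pushed forward by [W] is absolutely continuous with respect to the law of [W].
    Its Radon-Nikodym derivative is finite and lives directly on [T'], as the definition of a
    version demands. *)
Lemma is_cond_exp_exists X W : measurable_fun [set: T] W -> itg P X ->
  exists h, is_cond_exp P X W h.
Proof.
move=> mW iX.
pose W' : {mfun T >-> T'} := HB.pack W (isMeasurableFun.Build _ _ _ _ W mW).
have [nu nuE] : exists nu : {charge set T' -> \bar R},
    forall B, nu B = (\int[P]_(w in W @^-1` B) (X w)%:E)%E.
  by unshelve (eexists (pushforward (induced_charge iX) W)).
have numu : nu `<< distribution P W'.
  apply/null_content_dominatesP => B mB PB; rewrite nuE.
  have mWB := measurable_preimageT mW mB.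
  apply: null_set_integral => //.
  by apply: measurable_funTS; exact: measurable_int iX.
pose f := Radon_Nikodym nu (distribution P W').
have fi := Radon_Nikodym_integrable numu.
have ff x := Radon_Nikodym_fin_num x numu.
have mf := measurable_int _ fi.
have fiW : P.-integrable setT (f \o W).
  apply/integrableP; split; first exact: measurableT_comp.
  move/integrableP : fi => [_]; rewrite ge0_integral_distribution//.
  exact: measurableT_comp.
have fE : EFin \o (fine \o f) = f by apply/funext => x /=; rewrite fineK.
exists (fine \o f); split.
- by apply/measurable_EFinP; rewrite fE.
- by rewrite compA fE.
- move=> B mB; rewrite -nuE (Radon_Nikodym_integral numu)// -/f.
  have mWB := measurable_preimageT mW mB.
  have fiWB := integrableS measurableT mWB (@subsetT _ _) fiW.
  rewrite (integral_pushforward mW mf fiWB mB).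
  by apply: eq_integral => w _ /=; rewrite fineK.
Qed.

Lemma cond_expP X W : measurable_fun [set: T] W -> itg P X ->
  exists h, [/\ measurable_fun [set: T'] h, itg P (h \o W),
    cond_exp P X W = h \o W & cond_centered P (fun w => X w - h (W w)) W].
Proof.
move=> mW iX; rewrite /cond_exp; set h := xget _ _.
have ch : is_cond_exp P X W h := xgetPex _ (is_cond_exp_exists mW iX).
have [ih cc] := is_cond_exp_centered mW iX ch.
by exists h; case: ch.
Qed.

Lemma cond_exp_ae X W h : measurable_fun [set: T] W -> itg P X ->
  measurable_fun [set: T'] h ->
  cond_centered P (fun w => X w - h (W w)) W ->
  {ae P, forall w, cond_exp P X W w = h (W w)}.
Proof.
move=> mW iX mh ch; have [k [mk _ -> ck]] := cond_expP mW iX.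
have : {ae P, forall w, (fun x => k x - h x) (W w) = 0}.
  apply: (cond_centered_id mW (measurable_funB mk mh)).
  by apply: (cond_centered_ext _ (cond_centeredB mW ch ck)) => w /=; lra.
by apply: filterS => w /= /subr0_eq.
Qed.

(** With the converse [cond_exp_eq_centered], this trades an equality of conditional expectations,
    such as the bridge equation, for a centered difference in which no version is chosen. *)
Lemma cond_exp_eq_ae X1 X2 W : measurable_fun [set: T] W ->
  itg P X1 -> itg P X2 -> cond_centered P (fun w => X1 w - X2 w) W ->
  {ae P, forall w, cond_exp P X1 W w = cond_exp P X2 W w}.
Proof.
move=> mW i1 i2 c12; have [k [mk _ -> ck]] := cond_expP mW i2.
apply: cond_exp_ae => //.
by apply: (cond_centered_ext _ (cond_centeredD mW c12 ck)) => w /=; lra.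
Qed.

Lemma cond_exp_eq_centered X1 X2 W : measurable_fun [set: T] W ->
  itg P X1 -> itg P X2 ->
  {ae P, forall w, cond_exp P X1 W w = cond_exp P X2 W w} ->
  cond_centered P (fun w => X1 w - X2 w) W.
Proof.
move=> mW i1 i2.
have [k1 [_ _ -> c1]] := cond_expP mW i1.
have [k2 [_ _ -> c2]] := cond_expP mW i2.
move=> k12; apply: cond_centered_ae (cond_centeredB mW c1 c2) => //.
  by apply: (@itg_measurable _ _ _ P); exact: itgB.
by apply: filterS k12 => w /= ->; ring.
Qed.

End conditional_expectation.

(** * Conditioning on pairs and conditional independence *)

Section cond_centered_pair.
Context {d d' d1 : measure_display} {T : measurableType d}
  {T' : measurableType d'} {T1 : measurableType d1} {R : realType}.
Variable P : probability T R.

(** Dynkin's argument: rectangles are stable under intersection and generate the product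
    sigma-algebra, and the sets over which [D] integrates to 0 form a Dynkin system. Complements use
    the total integral, which is the case of the full rectangle. *)
Lemma cond_centered_pair (X : T -> T1) (W : T -> T') (D : T -> R) :
  measurable_fun [set: T] X -> measurable_fun [set: T] W -> itg P D ->
  (forall B C, measurable B -> measurable C ->
    (\int[P]_(w in (X @^-1` B) `&` (W @^-1` C)) (D w)%:E = 0)%E) ->
  cond_centered P D (fun w => (X w, W w)).
Proof.
move=> mX mW iD D0; split=> // F mF.
have mXW : measurable_fun [set: T] (fun w => (X w, W w)).
  exact: measurable_fun_pair.
have iDS S : measurable S -> P.-integrable S (EFin \o D).
  by move=> mS; exact: (integrableS measurableT).
have ST : (\int[P]_w (D w)%:E = 0)%E.
  by have := D0 _ _ measurableT measurableT; rewrite !preimage_setT setTI.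
pose Q (F : set (T1 * T')) :=
  (\int[P]_(w in (fun w => (X w, W w)) @^-1` F) (D w)%:E = 0)%E.
rewrite -/(Q F).
move: mF; rewrite measurable_prod_measurableType; move: F.
apply: dynkin_induction => //.
- by rewrite measurable_prod_measurableType.
- move=> _ _ [B mB [C mC <-]] [B' mB' [C' mC' <-]]; rewrite -setXI.
  exists (B `&` B'); first exact: measurableI.
  by exists (C `&` C') => //; exact: measurableI.
- by move=> _ [B mB [C mC <-]]; exact: D0.
- move=> S mS QS; rewrite /Q preimage_setC.
  have mS' := measurable_preimageT mXW mS.
  move: ST; rewrite -(setUv ((fun w => (X w, W w)) @^-1` S)).
  rewrite integral_setU//; last 3 first.
  + exact: measurableC.
  + by apply/measurable_EFinP; apply: measurable_funTS; exact: itg_measurable iD.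
  + by apply/disj_setPCl.
  by rewrite [X in (X + _)%E]QS add0e.
- move=> S mS tS QS; rewrite /Q preimage_bigcup integral_bigcup//.
  + by apply: eseries0 => i _ _; exact: QS.
  + apply/trivIsetP => i j _ _ ij; rewrite -preimage_setI.
    by move/trivIsetP : tS => /(_ _ _ I I ij) ->; rewrite preimage_set0.
  + by move=> k; exact: measurable_preimageT.
  + apply: iDS; apply: bigcupT_measurable => k.
    exact: measurable_preimageT.
Qed.

End cond_centered_pair.

Section conditional_independence.
Context {d d' d1 d2 : measure_display} {T : measurableType d}
  {T' : measurableType d'} {T1 : measurableType d1} {T2 : measurableType d2}
  {R : realType}.
Variable P : probability T R.

Lemma cond_probP (E : set T) (W : T -> T') : measurable_fun [set: T] W ->
  measurable E -> exists q, [/\ measurable_fun [set: T'] q,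
    ae_bounded P (q \o W), cond_prob P E W = q \o W &
    cond_centered P (fun w => \1_E w - q (W w)) W].
Proof.
move=> mW mE; have bE := ae_bounded_indic P mE.
have [q [mq iq qE cq]] := cond_expP mW (itg_ae_bounded bE).
by exists q; split=> //; exact: (cond_centered_bounded mW mq cq bE).
Qed.

(** Under the integral against phi(X1, W), the indicator of X2 in B2 may be replaced by its
    conditional probability q2(W), and q2(W) phi(X1, W) is centered given [W]. This is how
    conditional independence is used everywhere below. *)
Lemma cond_indep_centered (X1 : T -> T1) (X2 : T -> T2) (W : T -> T')
    (phi : T1 * T' -> R) :
  measurable_fun [set: T] X1 -> measurable_fun [set: T] X2 ->
  measurable_fun [set: T] W -> measurable_fun [set: T1 * T'] phi ->
  cond_indep P X1 X2 W ->
  cond_centered P (fun w => phi (X1 w, W w)) W ->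
  cond_centered P (fun w => phi (X1 w, W w)) (fun w => (X2 w, W w)).
Proof.
move=> m1 m2 mW mphi ind cphi; have iphi := cphi.1.
apply: cond_centered_pair => // B2 C mB2 mC.
have mX2 := measurable_preimageT m2 mB2.
have mWC := measurable_preimageT mW mC.
have [q2 [mq2 bq2 q2E cq2]] := cond_probP mW mX2.
(* X2 @^-1` B2 is independent of X1 given W, so q2(W) is also its conditional
   probability given (X1, W). *)
have c2 : cond_centered P (fun w => \1_(X2 @^-1` B2) w - q2 (W w))
    (fun w => (X1 w, W w)).
  apply: cond_centered_pair => //; first exact: cq2.1.
  move=> B1 C1 mB1 mC1.
  have mX1 := measurable_preimageT m1 mB1.
  have mWC1 := measurable_preimageT mW mC1.
  have [q1 [mq1 bq1 q1E cq1]] := cond_probP mW mX1.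
  have [q [mq bq qE cq]] := cond_probP mW (measurableI _ _ mX1 mX2).
  have c1 : cond_centered P
      (fun w => q2 (W w) * (\1_(X1 @^-1` B1) w - q1 (W w))) W.
    by apply: cond_centeredM => //; apply: itgM cq1.1.
  have c12 : cond_centered P (fun w => q (W w) - q2 (W w) * q1 (W w)) W.
    split; first by apply: itg_ae_bounded; apply: ae_boundedB => //;
      exact: ae_boundedM.
    move=> B mB; have mWB := measurable_preimageT mW mB.
    rewrite -[RHS](integral0 P (W @^-1` B)); apply: ae_eq_integral => //.
      by apply/measurable_EFinP; apply: measurable_funB;
        [|apply: measurable_funM]; apply: measurable_funTS; apply: measurableT_comp.
    have := ind _ _ mB1 mB2; rewrite qE q1E q2E.
    by apply: filterS => w /= -> _; rewrite mulrC subrr.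
  (* Writing I1 and I2 for the two indicators, the terms (I1 I2 - q) - q2 (I1 - q1) + (q - q2 q1)
     telescope to I1 (I2 - q2). *)
  have [_ /(_ _ mC1)] := cond_centeredD mW (cond_centeredB mW cq c1) c12.
  rewrite (integral_set_indic _ _ (measurableI _ _ mX1 mWC1)).
  rewrite (integral_set_indic _ _ mWC1) => <-; apply: eq_integral => w _.
  rewrite !indicI /=; congr (_%:E); ring.
have c3 : cond_centered P
    (fun w => phi (X1 w, W w) * (\1_(X2 @^-1` B2) w - q2 (W w)))
    (fun w => (X1 w, W w)).
  apply: cond_centeredM => //; first exact: measurable_fun_pair.
  by apply: itgMr => //; apply: ae_boundedB => //; exact: ae_bounded_indic.
have c4 : cond_centered P
    (fun w => phi (X1 w, W w) * (\1_(X2 @^-1` B2) w - q2 (W w))) W.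
  exact: (cond_centered_comp measurable_snd c3).
have c5 : cond_centered P (fun w => q2 (W w) * phi (X1 w, W w)) W.
  by apply: cond_centeredM => //; apply: itgM.
have [_ /(_ _ mC)] := cond_centeredD mW c4 c5.
rewrite (integral_set_indic _ _ (measurableI _ _ mX2 mWC)).
rewrite (integral_set_indic _ _ mWC) => <-; apply: eq_integral => w _.
rewrite !indicI /=; congr (_%:E); ring.
Qed.

End conditional_independence.

Lemma cond_indep_sym {d d' d1 d2 : measure_display} {T : measurableType d}
    {T' : measurableType d'} {T1 : measurableType d1} {T2 : measurableType d2}
    {R : realType} (P : probability T R) (X1 : T -> T1) (X2 : T -> T2)
    (W : T -> T') :
  cond_indep P X1 X2 W -> cond_indep P X2 X1 W.
Proof.
move=> ind B2 B1 mB2 mB1; rewrite setIC.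
by apply: filterS (ind _ _ mB1 mB2) => w ->; rewrite mulrC.
Qed.

(** * Decomposition of an additive propensity into its projections *)

Section additive_decomposition.
Context {d dZ dU dL : measure_display} {T : measurableType d}
  {TZ : measurableType dZ} {TU : measurableType dU} {TL : measurableType dL}
  {R : realType}.
Variable P : probability T R.
Implicit Types (Z : T -> TZ) (U : T -> TU) (L : T -> TL).

(* b and c need not be integrable.  Where P(|c(Z,L)| <= n | L) > 0, conditional
   independence forces |b(U,L)| <= n + C, so both are bounded on a
   sigma(L)-measurable event. *)
Lemma additive_bounded_fiber Z U L (b : TU * TL -> R) (c : TZ * TL -> R)
    (C : R) (n : nat) :
  measurable_fun [set: T] Z -> measurable_fun [set: T] U ->
  measurable_fun [set: T] L ->
  measurable_fun setT b -> measurable_fun setT c ->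
  cond_indep P Z U L ->
  {ae P, forall w, `|b (U w, L w) + c (Z w, L w)| <= C} ->
  exists q : TL -> R, [/\ measurable_fun setT q,
    {ae P, forall w, 0 < q (L w) -> `|b (U w, L w)| <= n%:R + C} &
    {ae P, forall w, `|c (Z w, L w)| <= n%:R -> 0 < q (L w)}].
Proof.
move=> mZ mU mL mb mc ind bcC.
have mUL : measurable_fun setT (fun w => (U w, L w)).
  exact: measurable_fun_pair.
have mZL : measurable_fun setT (fun w => (Z w, L w)).
  exact: measurable_fun_pair.
pose K := [set x : TZ * TL | `|c x| <= n%:R].
have mK : measurable K.
  rewrite (_ : K = (Num.norm \o c) @^-1` `]-oo, n%:R]%classic); last first.
    by apply/seteqP; split=> x; rewrite /K /= in_itv.
  by apply: measurable_preimageT => //; exact: measurableT_comp.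
pose E := [set x : TU * TL | n%:R + C < `|b x|].
have mE : measurable E.
  rewrite (_ : E = (Num.norm \o b) @^-1` `]n%:R + C, +oo[%classic); last first.
    by apply/seteqP; split=> x; rewrite /E /= in_itv /= andbT.
  by apply: measurable_preimageT => //; exact: measurableT_comp.
have mD := measurable_preimageT mZL mK.
have [q [mq bq _ cq]] := cond_probP P mL mD.
(* By conditional independence, q(L) is also the conditional probability of |c(Z,L)| <= n given
   (U,L). *)
have cqU : cond_centered P (fun w => \1_K (Z w, L w) - q (L w))
    (fun w => (U w, L w)).
  apply: (@cond_indep_centered _ _ _ _ _ _ _ _ _ P Z U L
    (fun x => \1_K x - q x.2)) => //.
  by apply: measurable_funB => //; exact: measurableT_comp.
pose G := [set l | 0 < q l].
have mG : measurable G.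
  rewrite (_ : G = q @^-1` `]0, +oo[%classic); last first.
    by apply/seteqP; split=> x; rewrite /G /= in_itv /= andbT.
  exact: measurable_preimageT.
exists q; split=> //.
(* On [B], |b| > n + C and |b + c| <= C force |c| > n, so the indicator of [K] is 0 and the centered
   difference reduces to q(L) > 0. Its integral over [B] is 0, hence [B] has a null preimage. *)
- pose B := E `&` snd @^-1` G.
  have mB : measurable B.
    by apply: measurableI => //; exact: measurable_preimageT.
  have BK w : `|b (U w, L w) + c (Z w, L w)| <= C -> B (U w, L w) ->
      \1_K (Z w, L w) = 0 :> R.
    move=> bc [Ew _]; rewrite indicE memNset// => Kw.
    move: Ew Kw; rewrite /E /K /= => Ew Kw.
    have := ler_normB (b (U w, L w) + c (Z w, L w)) (c (Z w, L w)).
    by rewrite addrK; lra.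
  have : {ae P, forall w, ((fun w => (U w, L w)) @^-1` B) w ->
      q (L w) - \1_K (Z w, L w) = 0}.
    apply: integral_eq0_ae.
    + exact: measurable_preimageT.
    + by apply: itgB; [exact: itg_ae_bounded|
        apply: itg_ae_bounded; exact: (ae_bounded_indic P mD)].
    + apply: filterS bcC => w bc Bw; rewrite (BK _ bc Bw) subr0.
      by case: Bw => _; exact: ltW.
    + have c0 : cond_centered P (fun w => q (L w) - \1_K (Z w, L w))
          (fun w => (U w, L w)).
        have := cond_centeredB mUL (cond_centered0 P _) cqU.
        by apply: cond_centered_ext => w; ring.
      exact: c0.2.
  apply: filterS2 bcC => w bc h Gw; rewrite leNgt; apply/negP => Ew.
  have Bw : B (U w, L w) by [].
  by have := h Bw; rewrite (BK _ bc Bw) subr0 => q0; rewrite q0 ltxx in Gw.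
(* Where q(L) <= 0, the difference between the indicator and q(L) is nonnegative with zero integral,
   so it vanishes; at a point of [K] this would give q(L) = 1. *)
- have : {ae P, forall w, (L @^-1` (~` G)) w ->
      \1_((fun w => (Z w, L w)) @^-1` K) w - q (L w) = 0}.
    apply: integral_eq0_ae.
    + by apply: measurable_preimageT => //; exact: measurableC.
    + exact: cq.1.
    + apply: aeW => w; rewrite /G /= => /negP; rewrite -leNgt => q0.
      by rewrite subr_ge0 (le_trans q0).
    + by apply: cq.2; exact: measurableC.
  apply: filterS => w h Kw; rewrite ltNge; apply/negP => q0.
  have /h : (L @^-1` (~` G)) w by rewrite /G /=; apply/negP; rewrite -leNgt.
  by rewrite indicE mem_set//= => /eqP; rewrite subr_eq0 => /eqP q1; lra.
Qed.

Lemma additive_projection Z U L (p : T -> R) (b : TU * TL -> R)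
    (c : TZ * TL -> R) (beta : TU * TL -> R) (gamma : TZ * TL -> R)
    (delta : TL -> R) :
  measurable_fun [set: T] Z -> measurable_fun [set: T] U ->
  measurable_fun [set: T] L ->
  measurable_fun setT b -> measurable_fun setT c ->
  measurable_fun setT beta -> measurable_fun setT gamma ->
  measurable_fun setT delta ->
  cond_indep P Z U L -> ae_bounded P p ->
  {ae P, forall w, p w = b (U w, L w) + c (Z w, L w)} ->
  cond_centered P (fun w => p w - beta (U w, L w)) (fun w => (U w, L w)) ->
  cond_centered P (fun w => p w - gamma (Z w, L w)) (fun w => (Z w, L w)) ->
  cond_centered P (fun w => p w - delta (L w)) L ->
  {ae P, forall w, p w = beta (U w, L w) + gamma (Z w, L w) - delta (L w)}.
Proof.
move=> mZ mU mL mb mc mbeta mgamma mdelta ind bp pE cbeta cgamma cdelta.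
have mUL : measurable_fun setT (fun w => (U w, L w)).
  exact: measurable_fun_pair.
have mZL : measurable_fun setT (fun w => (Z w, L w)).
  exact: measurable_fun_pair.
have bbeta := cond_centered_bounded mUL mbeta cbeta bp.
have bgamma := cond_centered_bounded mZL mgamma cgamma bp.
have bdelta := cond_centered_bounded mL mdelta cdelta bp.
have cbd : cond_centered P (fun w => beta (U w, L w) - delta (L w)) L.
  have := cond_centeredB mL cdelta (cond_centered_comp measurable_snd cbeta).
  by apply: cond_centered_ext => w; ring.
have cgd : cond_centered P (fun w => gamma (Z w, L w) - delta (L w)) L.
  have := cond_centeredB mL cdelta (cond_centered_comp measurable_snd cgamma).
  by apply: cond_centered_ext => w; ring.
(* Centering by [delta] gives mean 0 given L, and conditional independence extends this to (Z,L);
   [cgdU] is the symmetric fact. *)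
have cbdZ : cond_centered P (fun w => beta (U w, L w) - delta (L w))
    (fun w => (Z w, L w)).
  apply: (@cond_indep_centered _ _ _ _ _ _ _ _ _ P U Z L
    (fun x => beta x - delta x.2)) => //; last exact: cond_indep_sym.
  by apply: measurable_funB => //; exact: measurableT_comp.
have cgdU : cond_centered P (fun w => gamma (Z w, L w) - delta (L w))
    (fun w => (U w, L w)).
  apply: (@cond_indep_centered _ _ _ _ _ _ _ _ _ P Z U L
    (fun x => gamma x - delta x.2)) => //.
  by apply: measurable_funB => //; exact: measurableT_comp.
pose r w := p w - (beta (U w, L w) + gamma (Z w, L w) - delta (L w)).
have rZ : cond_centered P r (fun w => (Z w, L w)).
  have := cond_centeredB mZL cgamma cbdZ.
  by apply: cond_centered_ext => w; rewrite /r; ring.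
have rU : cond_centered P r (fun w => (U w, L w)).
  have := cond_centeredB mUL cbeta cgdU.
  by apply: cond_centered_ext => w; rewrite /r; ring.
have br : ae_bounded P r.
  by apply: ae_boundedB => //; apply: ae_boundedB => //; exact: ae_boundedD.
have [mp [C pC]] := bp.
have bcC : {ae P, forall w, `|b (U w, L w) + c (Z w, L w)| <= C}.
  by apply: filterS2 pC pE => w pC <-.
(* At each level n the residual vanishes where q(L) > 0, and this covers the event |c(Z,L)| <= n. *)
have main n : exists q : TL -> R,
    {ae P, forall w, (0 < q (L w) -> r w = 0) /\
      (`|c (Z w, L w)| <= n%:R -> 0 < q (L w))}.
  have [q [mq qb qc]] := additive_bounded_fiber n mZ mU mL mb mc ind bcC.
  exists q.
  pose G := [set l | 0 < q l].
  have mG : measurable G.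
    rewrite (_ : G = q @^-1` `]0, +oo[%classic); last first.
      by apply/seteqP; split=> x; rewrite /G /= in_itv /= andbT.
    exact: measurable_preimageT.
  have mLG := measurable_preimageT mL mG.
  have mGU : measurable_fun setT (fun x : TU * TL => \1_G x.2 : R).
    by apply: measurableT_comp => //; exact: measurable_indic.
  have mGZ : measurable_fun setT (fun x : TZ * TL => \1_G x.2 : R).
    by apply: measurableT_comp => //; exact: measurable_indic.
  (* [b'] and [c'] absorb the projections so that their sum is the residual on [G] and 0 elsewhere.
     Both are bounded, so each integrates to 0 against [r], which leaves a zero integral of r^2 over
     [G]. *)
  pose b' (x : TU * TL) := \1_G x.2 * (b x - beta x + delta x.2).
  pose c' (x : TZ * TL) := \1_G x.2 * (c x - gamma x).
  have mb' : measurable_fun setT b'.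
    apply: measurable_funM => //; apply: measurable_funD.
      exact: measurable_funB.
    exact: measurableT_comp.
  have mc' : measurable_fun setT c'.
    by apply: measurable_funM => //; exact: measurable_funB.
  have [C0 C0P] : exists C0 : R, {ae P, forall w, 0 < q (L w) ->
      `|b (U w, L w)| <= C0 /\ `|c (Z w, L w)| <= C0 + C}.
    exists (n%:R + C); apply: filterS2 qb bcC => w qb bc /qb bn; split => //.
    have := ler_normB (b (U w, L w) + c (Z w, L w)) (b (U w, L w)).
    by rewrite addrAC subrr add0r; lra.
  have bb : ae_bounded P (fun w => \1_G (L w) * b (U w, L w)).
    split.
      apply: (measurableT_comp (f := fun x => \1_G x.2 * b x) _ mUL).
      exact: measurable_funM.
    exists `|C0|; apply: filterS C0P => w C0P; rewrite indicE.
    have [/set_mem/C0P[bC _]|_] := boolP (L w \in G).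
      by rewrite mul1r (le_trans bC)// ler_norm.
    by rewrite mul0r normr0.
  have bc : ae_bounded P (fun w => \1_G (L w) * c (Z w, L w)).
    split.
      apply: (measurableT_comp (f := fun x => \1_G x.2 * c x) _ mZL).
      exact: measurable_funM.
    exists `|C0 + C|; apply: filterS C0P => w C0P; rewrite indicE.
    have [/set_mem/C0P[_ cC]|_] := boolP (L w \in G).
      by rewrite mul1r (le_trans cC)// ler_norm.
    by rewrite mul0r normr0.
  have bG := ae_bounded_indic P mLG.
  have bb' : ae_bounded P (fun w => b' (U w, L w)).
    under [fun w => _]funext => w do rewrite /b' -addrA mulrDr.
    apply: ae_boundedD => //; apply: (ae_boundedM bG).
    under [fun w => _]funext => w do rewrite addrC.
    exact: ae_boundedB.
  have bc' : ae_bounded P (fun w => c' (Z w, L w)).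
    under [fun w => _]funext => w do rewrite /c' mulrBr.
    by apply: ae_boundedB => //; exact: (ae_boundedM bG).
  have ir := itg_ae_bounded br.
  have ib := itgM bb' ir.
  have ic := itgM bc' ir.
  have sum0 : (\int[P]_w (b' (U w, L w) * r w + c' (Z w, L w) * r w)%:E = 0)%E.
    under eq_integral do rewrite EFinD.
    rewrite integralD//.
    by rewrite (integral_centeredM mUL mb' rU ib)
      (integral_centeredM mZL mc' rZ ic) adde0.
  have rE : {ae P, forall w, b' (U w, L w) * r w + c' (Z w, L w) * r w =
      \1_G (L w) * (r w) ^+ 2}.
    by apply: filterS pE => w pE; rewrite /b' /c' /r /= pE; ring.
  have : {ae P, forall w, [set: T] w ->
      b' (U w, L w) * r w + c' (Z w, L w) * r w = 0}.
    apply: integral_eq0_ae => //; first exact: itgD.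
    by apply: filterS rE => w -> _; rewrite mulr_ge0// sqr_ge0.
  apply: filterS3 qc rE => w qc rE r0; split=> // Gw.
  have /eqP := r0 I; rewrite rE indicE mem_set// mul1r sqrf_eq0.
  by move/eqP.
(* The countably many null sets are merged; as c(Z,L) is real-valued, each point falls under some
   level n. *)
have [q qP] := choice main.
have := ae_foralln qP.
apply: filterS => w h; apply/eqP; rewrite -subr_eq0; apply/eqP.
have [n cn] : exists n : nat, `|c (Z w, L w)| <= n%:R.
  exists (Num.bound `|c (Z w, L w)|); apply: ltW.
  exact: archi_boundP.
by have [r0 q0] := h n; exact/r0/q0.
Qed.

End additive_decomposition.

(** * The bridge equation in centered form *)

Section bridge.
Context {d dZ dU dL : measure_display} {T : measurableType d}
  {TZ : measurableType dZ} {TU : measurableType dU} {TL : measurableType dL}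
  {R : realType}.
Variable P : probability T R.
Implicit Types (Z : T -> TZ) (U : T -> TU) (L : T -> TL).

(** Names versions of both means and of the covariance, so that nested conditional expectations
    become centered differences. Boundedness of [X2] makes the product integrable. *)
Lemma cond_covP (X1 X2 : T -> R) L : measurable_fun [set: T] L ->
  itg P X1 -> ae_bounded P X2 -> exists x1 x2 k : TL -> R,
  [/\ [/\ measurable_fun setT x1, measurable_fun setT x2 &
          measurable_fun setT k],
      [/\ itg P (x1 \o L), ae_bounded P (x2 \o L) & itg P (k \o L)],
      cond_centered P (fun w => X1 w - x1 (L w)) L,
      cond_centered P (fun w => X2 w - x2 (L w)) L &
      cond_cov P X1 X2 L = k \o L /\
      cond_centered P
        (fun w => (X1 w - x1 (L w)) * (X2 w - x2 (L w)) - k (L w)) L].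
Proof.
move=> mL i1 b2; have i2 := itg_ae_bounded b2.
have [x1 [m1 ix1 e1 c1]] := cond_expP mL i1.
have [x2 [m2 ix2 e2 c2]] := cond_expP mL i2.
have bx2 := cond_centered_bounded mL m2 c2 b2.
have i12 : itg P (fun w => (X1 w - x1 (L w)) * (X2 w - x2 (L w))).
  by apply: itgMr; [exact: itgB|exact: ae_boundedB].
have [k [mk ik ek ck]] := cond_expP mL i12.
exists x1, x2, k; split=> //; split=> //.
by rewrite /cond_cov e1 e2.
Qed.

(** With p = beta + gamma - delta, the target equals the sum A (Ya - m) + m (A - p) +
    [(m - mu)(beta - delta) - kappa] + mu (beta - delta) + gamma (m - mu) - mu (A - gamma), each
    term of which is centered given (Z,L). *)
Lemma bridge_centered Z U L (A Ya p : T -> R) (m : TU * TL -> R)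
    (beta : TU * TL -> R) (gamma : TZ * TL -> R) (mu delta kappa : TL -> R) :
  measurable_fun [set: T] Z -> measurable_fun [set: T] U ->
  measurable_fun [set: T] L ->
  measurable_fun setT m -> measurable_fun setT beta ->
  measurable_fun setT gamma -> measurable_fun setT mu ->
  measurable_fun setT delta -> measurable_fun setT kappa ->
  itg P (fun w => m (U w, L w)) -> itg P (mu \o L) -> itg P (kappa \o L) ->
  ae_bounded P A -> ae_bounded P p ->
  cond_indep P Z U L ->
  cond_centered P (fun w => A w * (Ya w - m (U w, L w)))
    (fun w => (Z w, U w, L w)) ->
  cond_centered P (fun w => m (U w, L w) * (A w - p w))
    (fun w => (Z w, U w, L w)) ->
  cond_centered P (fun w => A w - gamma (Z w, L w)) (fun w => (Z w, L w)) ->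
  cond_centered P (fun w => p w - beta (U w, L w)) (fun w => (U w, L w)) ->
  cond_centered P (fun w => p w - gamma (Z w, L w)) (fun w => (Z w, L w)) ->
  cond_centered P (fun w => p w - delta (L w)) L ->
  cond_centered P (fun w => m (U w, L w) - mu (L w)) L ->
  cond_centered P (fun w =>
    (m (U w, L w) - mu (L w)) * (p w - delta (L w)) - kappa (L w)) L ->
  {ae P, forall w, p w = beta (U w, L w) + gamma (Z w, L w) - delta (L w)} ->
  cond_centered P (fun w => A w * Ya w - (kappa (L w) + mu (L w) * A w))
    (fun w => (Z w, L w)).
Proof.
move=> mZ mU mL mm mbeta mgamma mmu mdelta mkappa im imu ikappa bA bp ind
  cAY cmA cAgamma cbeta cgamma cdelta cmu ckappa pE.
have mUL : measurable_fun setT (fun w => (U w, L w)).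
  exact: measurable_fun_pair.
have mZL : measurable_fun setT (fun w => (Z w, L w)).
  exact: measurable_fun_pair.
pose prZL (x : TZ * TU * TL) := (x.1.1, x.2).
have mprZL : measurable_fun setT prZL.
  apply: measurable_fun_pair => //.
  exact: (measurableT_comp measurable_fst measurable_fst).
have bbeta := cond_centered_bounded mUL mbeta cbeta bp.
have bgamma := cond_centered_bounded mZL mgamma cgamma bp.
have bdelta := cond_centered_bounded mL mdelta cdelta bp.
have imm : itg P (fun w => m (U w, L w) - mu (L w)) by exact: itgB.
have bbd : ae_bounded P (fun w => beta (U w, L w) - delta (L w)).
  exact: ae_boundedB.
have bgd : ae_bounded P (fun w => gamma (Z w, L w) - delta (L w)).
  exact: ae_boundedB.
have indUZ := cond_indep_sym ind.
have mdelta_snd : measurable_fun setT (fun x : TZ * TL => delta x.2).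
  exact: measurableT_comp.
have mdelta_sndU : measurable_fun setT (fun x : TU * TL => delta x.2).
  exact: measurableT_comp.
have mmu_snd : measurable_fun setT (fun x : TZ * TL => mu x.2).
  exact: measurableT_comp.
have mmu_sndU : measurable_fun setT (fun x : TU * TL => mu x.2).
  exact: measurableT_comp.
have mkappa_sndU : measurable_fun setT (fun x : TU * TL => kappa x.2).
  exact: measurableT_comp.
have c1 : cond_centered P (fun w => m (U w, L w) - mu (L w))
    (fun w => (Z w, L w)).
  apply: (@cond_indep_centered _ _ _ _ _ _ _ _ _ P U Z L
    (fun x => m x - mu x.2)) => //; exact: measurable_funB.
have c2 : cond_centered P (fun w => beta (U w, L w) - delta (L w))
    (fun w => (Z w, L w)).
  apply: (@cond_indep_centered _ _ _ _ _ _ _ _ _ P U Z L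
    (fun x => beta x - delta x.2)) => //; first exact: measurable_funB.
  have := cond_centeredB mL cdelta (cond_centered_comp measurable_snd cbeta).
  by apply: cond_centered_ext => w; ring.
(* Because of this term, p - delta may be replaced by beta - delta in the covariance with [m] given
   L. *)
have c3 : cond_centered P (fun w =>
    (gamma (Z w, L w) - delta (L w)) * (m (U w, L w) - mu (L w))) L.
  apply: (cond_centered_comp (W := fun w => (Z w, L w)) measurable_snd).
  apply: (cond_centeredM (phi := fun x => gamma x - delta x.2)) => //.
    exact: measurable_funB.
  exact: itgM.
(* Once p is replaced by beta, the covariance residual depends on (U,L) only, and conditional
   independence carries its centering from L to (Z,L). *)
have c4 : cond_centered P (fun w => (m (U w, L w) - mu (L w)) *
    (beta (U w, L w) - delta (L w)) - kappa (L w)) (fun w => (Z w, L w)).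
  apply: (@cond_indep_centered _ _ _ _ _ _ _ _ _ P U Z L
    (fun x => (m x - mu x.2) * (beta x - delta x.2) - kappa x.2)) => //.
    apply: measurable_funB => //.
    by apply: measurable_funM; exact: measurable_funB.
  apply: cond_centered_ae (cond_centeredB mL ckappa c3) => //.
    by apply: (@itg_measurable _ _ _ P); apply: itgB => //; exact: itgMr.
  by apply: filterS pE => w -> /=; ring.
have c5 : cond_centered P
    (fun w => mu (L w) * (beta (U w, L w) - delta (L w)))
    (fun w => (Z w, L w)).
  apply: (cond_centeredM (W := fun w => (Z w, L w))
    (phi := fun x : TZ * TL => mu x.2)) => //.
  exact: itgMr.
have c6 : cond_centered P
    (fun w => gamma (Z w, L w) * (m (U w, L w) - mu (L w)))
    (fun w => (Z w, L w)).
  by apply: cond_centeredM => //; exact: itgM.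
have c7 := cond_centered_comp mprZL cAY.
have c8 := cond_centered_comp mprZL cmA.
have c9 : cond_centered P (fun w => mu (L w) * (A w - gamma (Z w, L w)))
    (fun w => (Z w, L w)).
  apply: (cond_centeredM (W := fun w => (Z w, L w))
    (phi := fun x : TZ * TL => mu x.2)) => //.
  by apply: itgMr => //; exact: ae_boundedB.
have := cond_centeredB mZL
  (cond_centeredD mZL (cond_centeredD mZL c7 c8)
    (cond_centeredD mZL c4 (cond_centeredD mZL c5 c6))) c9.
apply: cond_centered_ae => //.
  apply: (@itg_measurable _ _ _ P); apply: itgB; last first.
    by apply: itgD => //; exact: itgMr.
  have := itgD cAY.1 (itgM bA im).
  by congr (itg P _); apply/funext => w; ring.
by apply: filterS pE => w /= ->; ring.
Qed.

(* The bridge functions need not be separately integrable, hence the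
   localization to |g0|, |g1| <= n. *)
Lemma centered_affine Z L (A : T -> R) (g0 g1 : TL -> R) (gamma : TZ * TL -> R) :
  measurable_fun [set: T] Z -> measurable_fun [set: T] L ->
  measurable_fun setT g0 -> measurable_fun setT g1 ->
  measurable_fun setT gamma -> ae_bounded P A ->
  cond_centered P (fun w => A w - gamma (Z w, L w)) (fun w => (Z w, L w)) ->
  cond_centered P (fun w => g0 (L w) + g1 (L w) * A w) (fun w => (Z w, L w)) ->
  {ae P, forall w, g0 (L w) + g1 (L w) * gamma (Z w, L w) = 0}.
Proof.
move=> mZ mL mg0 mg1 mgamma bA cgamma cg.
have mZL : measurable_fun setT (fun w => (Z w, L w)).
  exact: measurable_fun_pair.
pose S n := [set l | `|g0 l| <= n%:R] `&` [set l | `|g1 l| <= n%:R].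
have mle (g : TL -> R) n : measurable_fun setT g ->
    measurable [set l | `|g l| <= n%:R].
  move=> mg; rewrite (_ : [set l | _] = (Num.norm \o g) @^-1` `]-oo, n%:R]%classic).
    by apply: measurable_preimageT => //; exact: measurableT_comp.
  by apply/seteqP; split=> x; rewrite /= in_itv.
have mS n : measurable (S n) by apply: measurableI; exact: mle.
have m2 (g : TL -> R) : measurable_fun setT g ->
    measurable_fun setT (fun x : TZ * TL => g x.2).
  by move=> mg; exact: measurableT_comp.
have mI n : measurable_fun setT (\1_(S n) : TL -> R) by exact: measurable_indic.
have bS (g : TL -> R) n : measurable_fun setT g ->
    (forall l, S n l -> `|g l| <= n%:R) ->
    ae_bounded P (fun w => \1_(S n) (L w) * g (L w)).
  move=> mg gn; split.
    apply: (measurableT_comp (f := fun l => \1_(S n) l * g l) _ mL).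
    exact: measurable_funM.
  exists n%:R; apply: aeW => w; rewrite indicE.
  have [/set_mem/gn|_] := boolP (L w \in S n); first by rewrite mul1r.
  by rewrite mul0r normr0.
have main n : {ae P, forall w,
    S n (L w) -> g0 (L w) + g1 (L w) * gamma (Z w, L w) = 0}.
  have b0 : ae_bounded P (fun w => \1_(S n) (L w) * g0 (L w)).
    by apply: bS => // l [].
  have b1 : ae_bounded P (fun w => \1_(S n) (L w) * g1 (L w)).
    by apply: bS => // l [].
  have c1 : cond_centered P
      (fun w => \1_(S n) (L w) * (g0 (L w) + g1 (L w) * A w))
      (fun w => (Z w, L w)).
    apply: (cond_centeredM (W := fun w => (Z w, L w))
      (phi := fun x : TZ * TL => \1_(S n) x.2)) => //; first exact: m2.
    apply: itgM cg.1.
    exact: (ae_bounded_indic P (measurable_preimageT mL (mS n))).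
  have c2 : cond_centered P
      (fun w => (\1_(S n) (L w) * g1 (L w)) * (A w - gamma (Z w, L w)))
      (fun w => (Z w, L w)).
    apply: (cond_centeredM (W := fun w => (Z w, L w))
      (phi := fun x : TZ * TL => \1_(S n) x.2 * g1 x.2)) => //.
      by apply: measurable_funM; exact: m2.
    exact: (itgM b1 cgamma.1).
  pose h (x : TZ * TL) := \1_(S n) x.2 * (g0 x.2 + g1 x.2 * gamma x).
  have mh : measurable_fun setT h.
    apply: measurable_funM; first exact: m2.
    by apply: measurable_funD; [|apply: measurable_funM => //]; exact: m2.
  have ch : cond_centered P (fun w => h (Z w, L w)) (fun w => (Z w, L w)).
    by apply: (cond_centered_ext _ (cond_centeredB mZL c1 c2)) => w;
      rewrite /h /=; ring.
  apply: filterS (cond_centered_id mZL mh ch) => w.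
  by rewrite /h /= => + Sw; rewrite indicE mem_set// mul1r.
have := ae_foralln main; apply: filterS => w h.
pose N := Num.bound (`|g0 (L w)| + `|g1 (L w)|).
have lt0 : `|g0 (L w)| + `|g1 (L w)| < N%:R by exact: archi_boundP.
by apply: (h N); split=> /=; apply: ltW; apply: le_lt_trans lt0;
  rewrite ?lerDl ?lerDr.
Qed.

End bridge.

(** * Measurability auxiliaries and proof of the theorem *)

Lemma measurable_funV {d : measure_display} {T : measurableType d}
    {R : realType} (f : T -> R) :
  measurable_fun [set: T] f -> measurable_fun [set: T] (fun w => (f w)^-1).
Proof.
move=> mf.
(* Squaring makes the base nonnegative, so the measurable real power applies; where f vanishes both
   sides are 0, the conventional inverse of 0. *)
have -> : (fun w => (f w)^-1) = (fun w => f w * (f w ^+ 2) `^ (-1)).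
  apply/funext => w; rewrite powR_inv1 ?sqr_ge0// expr2 invfM mulrA.
  by have [->|f0] := eqVneq (f w) 0; rewrite ?invr0 ?mulr0// divff// mul1r.
apply: measurable_funM => //.
by apply: (measurableT_comp (measurable_powR _)); exact: measurable_funX.
Qed.

(** Every subset of the domain is measurable for its discrete sigma-algebra. *)
Lemma measurable_fun_ord {n : nat} {d : measure_display}
    {T : measurableType d} (f : 'I_n.+1 -> T) : measurable_fun [set: 'I_n.+1] f.
Proof. by []. Qed.

Theorem theorem2p2 (R : realType) (d dU : measure_display)
  (T : measurableType d) (TU : measurableType dU) (P : probability T R)
  (M dZ dL : nat) (SZ : set (dZ.-tuple R)) (SL : set (dL.-tuple R))
  (A : {RV P >-> 'I_M.+1}) (Z : {RV P >-> dZ.-tuple R}) (U : {RV P >-> TU})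
  (L : {RV P >-> dL.-tuple R}) (Y : {RV P >-> R})
  (Ypot : 'I_M.+1 -> {RV P >-> R}) (a : 'I_M.+1)
  (Z_in : forall w, SZ (Z w)) (L_in : forall w, SL (L w))
  (hcons : consistency P A Y Ypot)
  (hign : latent_ignorability P A Z U L Ypot)
  (hind : iv_independence P Z U L)
  (hrel : iv_relevance P SZ SL A Z L)
  (hmom : P.-integrable setT (EFin \o Ypot a))
  (hadd : additive_iv P A Z U L a) :
  (exists fo : bool -> dL.-tuple R -> R,
    [/\ solves_bridge P A Z L Y a fo,
        {ae P, forall w, fo false (L w) = confounding_cov P A Z U L Ypot a w},
        {ae P, forall w, fo true (L w) =
          confounding_cov P A Z U L Ypot a w + cond_exp P (Ypot a) L w} &
        forall f, solves_bridge P A Z L Y a f ->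
          forall i, {ae P, forall w, f i (L w) = fo i (L w)}]) /\
  (forall pi : dZ.-tuple R -> dL.-tuple R -> R,
    regular_weighting P SZ SL A Z L a pi ->
    ('E_P[Ypot a] =
     'E_P[fun w =>
       (cond_cov P (fun w => trtR A a w * Y w) (fun w => pi (Z w) (L w)) L w /
        cond_cov P (trtR A a) (fun w => pi (Z w) (L w)) L w)%R])%E).
Proof.
have mA : measurable_fun setT A by exact: measurable_funPT.
have mZ : measurable_fun setT Z by exact: measurable_funPT.
have mU : measurable_fun setT U by exact: measurable_funPT.
have mL : measurable_fun setT L by exact: measurable_funPT.
have mY : measurable_fun setT Y by exact: measurable_funPT.
have mYa : measurable_fun setT (Ypot a) by exact: measurable_funPT.
have mZL : measurable_fun setT (fun w => (Z w, L w)).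
  exact: measurable_fun_pair.
have mUL : measurable_fun setT (fun w => (U w, L w)).
  exact: measurable_fun_pair.
have mZUL : measurable_fun setT (fun w => (Z w, U w, L w)).
  by apply: measurable_fun_pair => //; exact: measurable_fun_pair.
have mAZ : measurable_fun setT (fun w => (A w, Z w)).
  exact: measurable_fun_pair.
have mE : measurable [set w | A w = a].
  by apply: (@measurable_preimageT _ _ _ _ A [set a]).
have trtE : trtR A a = \1_[set w | A w = a] :> (T -> R).
  apply/funext => w; rewrite /trtR /trt indicE; congr (nat_of_bool _)%:R.
  by apply/eqP/idP => [Aa|/set_mem//]; exact: mem_set.
have bA : ae_bounded P (trtR A a) by rewrite trtE; exact: ae_bounded_indic.
have mtrt := bA.1.
have iAYa : itg P (fun w => trtR A a w * Ypot a w) by exact: itgM.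
have mAY : measurable_fun setT (fun w => trtR A a w * Y w).
  exact: measurable_funM.
(* Consistency gives Y = Y(a) where A = a, and both products vanish elsewhere. *)
have AYE : {ae P, forall w, trtR A a w * Y w = trtR A a w * Ypot a w}.
  apply: filterS hcons => w ->; rewrite /trtR /trt.
  by case: eqP => [->|_]; rewrite ?mul0r.
have iAY : itg P (fun w => trtR A a w * Y w) by exact: itg_ae AYE.
have [p [mp bp pE cp]] := cond_probP P mZUL mE.
rewrite -trtE in cp.
have [m [mm im mE' cm]] := cond_expP mUL hmom.
have ip := itg_ae_bounded bp.
have [beta [mbeta _ _ cbeta]] := cond_expP mUL ip.
have [gamma [mgamma _ _ cgamma]] := cond_expP mZL ip.
have [mu [delta [kappa [[mmu mdelta mkappa] [imu _ ikappa] cmu cdelta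
  [kappaE ckappa]]]]] := cond_covP mL im bp.
have bgamma := cond_centered_bounded mZL mgamma cgamma bp.
have [b [c [mb mc bcE]]] := hadd.
rewrite /latent_propensity pE in bcE.
have pEb := additive_projection mZ mU mL mb mc mbeta mgamma mdelta hind bp bcE
  cbeta cgamma cdelta.
(* [gamma] was introduced as the projection of [p]; by the tower property it is also that of the
   treatment indicator. *)
have cAgamma : cond_centered P (fun w => trtR A a w - gamma (Z w, L w))
    (fun w => (Z w, L w)).
  have mpr : measurable_fun setT
      (fun x : dZ.-tuple R * TU * dL.-tuple R => (x.1.1, x.2)).
    apply: measurable_fun_pair => //.
    exact: (measurableT_comp measurable_fst measurable_fst).
  have := cond_centeredD mZL (cond_centered_comp mpr cp) cgamma.
  by apply: cond_centered_ext => w /=; ring.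
(* Latent ignorability makes Y(a) - m centered given (A,Z,U,L). The treatment indicator is a
   function of A and can be multiplied in before A is dropped from the conditioning. *)
have cAY : cond_centered P (fun w => trtR A a w * (Ypot a w - m (U w, L w)))
    (fun w => (Z w, U w, L w)).
  pose pr (x : ('I_M.+1 * dZ.-tuple R) * (TU * dL.-tuple R)) :=
    (x.1.2, x.2.1, x.2.2).
  have mpr : measurable_fun setT pr.
    apply: measurable_fun_pair; first apply: measurable_fun_pair.
    - exact: (measurableT_comp measurable_snd measurable_fst).
    - exact: (measurableT_comp measurable_fst measurable_snd).
    - exact: (measurableT_comp measurable_snd measurable_snd).
  apply: (cond_centered_comp (W := fun w => ((A w, Z w), (U w, L w))) mpr).
  apply: (cond_centeredM (W := fun w => ((A w, Z w), (U w, L w)))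
    (phi := fun x : ('I_M.+1 * dZ.-tuple R) * (TU * dL.-tuple R) =>
      (x.1.1 == a)%:R)).
  - exact: measurable_fun_pair.
  - pose t (i : 'I_M.+1) : R := (i == a)%:R.
    exact: (measurableT_comp (measurable_fun_ord t)
      (measurableT_comp measurable_fst measurable_fst)).
  - exact: (itgM bA cm.1).
  - apply: (@cond_indep_centered _ _ _ _ _ _ _ _ _ P (Ypot a)
      (fun w => (A w, Z w)) (fun w => (U w, L w)) (fun x => x.1 - m x.2)) => //.
    by apply: measurable_funB => //; exact: measurableT_comp.
have cmA : cond_centered P
    (fun w => m (U w, L w) * (trtR A a w - p (Z w, U w, L w)))
    (fun w => (Z w, U w, L w)).
  apply: (cond_centeredM (W := fun w => (Z w, U w, L w))
    (phi := fun x : dZ.-tuple R * TU * dL.-tuple R => m (x.1.2, x.2))) => //.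
    apply: (measurableT_comp mm); apply: measurable_fun_pair => //.
    exact: (measurableT_comp measurable_snd measurable_fst).
  by apply: itgMr => //; exact: ae_boundedB.
have key : cond_centered P
    (fun w => trtR A a w * Y w - (kappa (L w) + mu (L w) * trtR A a w))
    (fun w => (Z w, L w)).
  have := bridge_centered mZ mU mL mm mbeta mgamma mmu mdelta mkappa im imu
    ikappa bA bp hind cAY cmA cAgamma cbeta cgamma cdelta cmu ckappa pEb.
  apply: cond_centered_ae => //.
    apply: measurable_funB => //; apply: measurable_funD.
      exact: measurableT_comp.
    by apply: measurable_funM => //; exact: measurableT_comp.
  by apply: filterS AYE => w ->.
(* The term kappa + mu A in [key] is affine in a 0/1 variable, so its values at 0 and 1 define the
   bridge function. *)
pose fo (i : bool) l := kappa l + mu l * i%:R.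
have mfo i : measurable_fun setT (fo i).
  by apply: measurable_funD => //; exact: measurable_funM.
have ifo : itg P (fun w => fo (trt A a w) (L w)).
  by apply: itgD => //; exact: itgMr.
have cYmu : cond_centered P (fun w => Ypot a w - mu (L w)) L.
  have := cond_centeredD mL (cond_centered_comp measurable_snd cm) cmu.
  by apply: cond_centered_ext => w /=; ring.
split.
  exists fo; split.
  - split=> //; exact: cond_exp_eq_ae.
  - apply: aeW => w; rewrite /confounding_cov /latent_propensity mE' pE kappaE.
    by rewrite /fo mulr0 addr0.
  - have := cond_exp_ae mL hmom mmu cYmu.
    apply: filterS => w ->.
    by rewrite /confounding_cov /latent_propensity mE' pE kappaE /fo mulr1.
  move=> f [mf itf fE] i.
  have cX := cond_exp_eq_centered mZL iAY itf fE.
  have cf : cond_centered P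
      (fun w => f (trt A a w) (L w) - fo (trt A a w) (L w))
      (fun w => (Z w, L w)).
    have := cond_centeredB mZL key cX; apply: cond_centered_ext => w.
    by rewrite /fo /trtR; ring.
  pose g0 l := f false l - fo false l.
  pose g1 l := f true l - fo true l - g0 l.
  have mg0 : measurable_fun setT g0 by exact: measurable_funB.
  have mg1 : measurable_fun setT g1.
    by apply: measurable_funB => //; exact: measurable_funB.
  (* The difference of two solutions is again affine in the 0/1 treatment indicator. *)
  have cg : cond_centered P (fun w => g0 (L w) + g1 (L w) * trtR A a w)
      (fun w => (Z w, L w)).
    apply: cond_centered_ext cf => w; rewrite /g1 /g0 /trtR.
    by case: (trt A a w); rewrite /=; ring.
  have gE := centered_affine mZ mL mg0 mg1 mgamma bA cAgamma cg.
  (* Where g1(l) is nonzero, the relation g0 + g1 gamma = 0 lets gamma be replaced by a value free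
     of z without leaving the class of versions of the propensity given (Z,L). *)
  pose p' (x : dZ.-tuple R * dL.-tuple R) :=
    if g1 x.2 == 0 then gamma x else - g0 x.2 / g1 x.2.
  have mp' : measurable_fun setT p'.
    have m2 (g : dL.-tuple R -> R) : measurable_fun setT g ->
        measurable_fun setT (fun x : dZ.-tuple R * dL.-tuple R => g x.2).
      by move=> mg; exact: measurableT_comp.
    apply: measurable_fun_ifT => //.
      by apply: measurable_fun_eqr => //; exact: m2.
    apply: measurable_funM; last by apply: measurable_funV; exact: m2.
    by apply: measurable_funN; exact: m2.
  have p'E : {ae P, forall w, p' (Z w, L w) = gamma (Z w, L w)}.
    apply: filterS gE => w; rewrite /p' /=; case: eqVneq => // g10 /eqP.
    by rewrite addrC addr_eq0 => /eqP <-; rewrite mulrAC divff// mul1r.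
  have p'C : is_cond_exp P (\1_[set w | A w = a]) (fun w => (Z w, L w)) p'.
    rewrite -trtE; apply: centered_is_cond_exp => //.
    - exact: itg_ae_bounded.
    - apply: itg_ae p'E; first exact: itg_ae_bounded.
      exact: measurableT_comp.
    - apply: cond_centered_ae cAgamma => //.
        by apply: measurable_funB => //; exact: measurableT_comp.
      by apply: filterS p'E => w ->.
  (* Relevance applied to the version [p'] fails at every l in the range of L with g1(l) nonzero;
     the exceptional null set for the law of L is pulled back through L. *)
  have g1E : {ae P, forall w, g1 (L w) = 0}.
    have [N [mN PN0 subN]] := hrel a p' p'C.
    exists (L @^-1` N); split => //; first exact: measurable_preimageT.
    move=> w /= g10; apply: subN => /= /(_ (L_in w)) [z0 [z1 [_ _ _]]].
    by rewrite /p' /=; case: eqP.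
  apply: filterS2 g1E gE => w; rewrite /g1 => g10; rewrite g10 mul0r addr0 => g00.
  by case: i; move: g10; rewrite g00 ?subr0 => /eqP; rewrite subr_eq0 => /eqP;
    move: g00; rewrite /g0 => /eqP; rewrite subr_eq0 => /eqP.
move=> pi [mpi [C piC] [eps eps0 covge]].
have bpi : ae_bounded P (fun w => pi (Z w) (L w)).
  split; first exact: (measurableT_comp mpi mZL).
  by exists C; apply: aeW => w; exact: piC.
have [x1 [pb [C1 [[mx1 mpb mC1] [ix1 bpb iC1] cx1 cpb [C1E cC1]]]]] :=
  cond_covP mL iAY bpi.
have [ab [pb' [C2 [[mab mpb' mC2] [iab bpb' iC2] cab cpb' [C2E cC2]]]]] :=
  cond_covP mL (itg_ae_bounded bA) bpi.
have bab := cond_centered_bounded mL mab cab bA.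
have bC2 := cond_centered_bounded mL mC2 cC2
  (ae_boundedM (ae_boundedB bA bab) (ae_boundedB bpi bpb')).
(* The two covariances come with separate versions of E[pi | L], which agree almost surely. *)
have pbE : {ae P, forall w, pb' (L w) = pb (L w)}.
  have cpp : cond_centered P (fun w => (fun l => pb' l - pb l) (L w)) L.
    by have := cond_centeredB mL cpb cpb'; apply: cond_centered_ext => w; ring.
  apply: filterS (cond_centered_id mL (measurable_funB mpb' mpb) cpp) => w /=.
  by move/eqP; rewrite subr_eq0 => /eqP.
have mm2 : measurable_fun setT
    (fun x : dZ.-tuple R * dL.-tuple R => pi x.1 x.2 - pb x.2).
  by apply: measurable_funB => //; exact: measurableT_comp.
have c1 : cond_centered P (fun w => (pi (Z w) (L w) - pb (L w)) *
    (trtR A a w * Y w - (kappa (L w) + mu (L w) * trtR A a w))) L.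
  apply: (cond_centered_comp (W := fun w => (Z w, L w)) measurable_snd).
  apply: (cond_centeredM (W := fun w => (Z w, L w))
    (phi := fun x : dZ.-tuple R * dL.-tuple R => pi x.1 x.2 - pb x.2)) => //.
  by apply: itgM key.1; exact: ae_boundedB.
have c2 : cond_centered P
    (fun w => (kappa (L w) - x1 (L w) + mu (L w) * ab (L w)) *
      (pi (Z w) (L w) - pb (L w))) L.
  apply: (cond_centeredM (W := L)
    (phi := fun l => kappa l - x1 l + mu l * ab l)) => //.
    by apply: measurable_funD; [exact: measurable_funB|exact: measurable_funM].
  apply: itgMr; last exact: ae_boundedB.
  by apply: itgD; [exact: itgB|exact: itgMr].
have c3 : cond_centered P (fun w => mu (L w) *
    ((trtR A a w - ab (L w)) * (pi (Z w) (L w) - pb' (L w)) - C2 (L w))) L.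
  apply: (cond_centeredM (W := L) (phi := mu)) => //.
  apply: itgMr => //; apply: ae_boundedB => //.
  by apply: ae_boundedM; exact: ae_boundedB.
pose h l := C1 l - mu l * C2 l.
have mh : measurable_fun setT h.
  by apply: measurable_funB => //; exact: measurable_funM.
have ch : cond_centered P (fun w => h (L w)) L.
  (* [c1] is the weighted bridge equation, [c2] recenters AY and A at their means given L, and [c3]
     and [cC1] trade the products for the covariances; what remains is C1 - mu C2. *)
  have := cond_centeredB mL (cond_centeredD mL (cond_centeredD mL c1 c2) c3) cC1.
  apply: cond_centered_ae => //; first exact: measurableT_comp.
  by apply: filterS pbE => w; rewrite /h /= => ->; ring.
have hE := cond_centered_id mL mh ch.
(* The lower bound [eps] on |C2(L)| excludes a zero denominator. *)
have ratioE : {ae P, forall w, C1 (L w) / C2 (L w) = mu (L w)}.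
  apply: filterS2 hE covge => w; rewrite /h C2E /= => /eqP; rewrite subr_eq0.
  move=> /eqP -> ge; rewrite mulfK//; apply: contraTneq ge => ->.
  by rewrite normr0 -ltNge.
rewrite unlock C1E C2E.
(* Both sides are compared with E[mu(L)], the left one because mu(L) is a version of E[Y(a) | L]. *)
transitivity (\int[P]_w (mu (L w))%:E)%E.
  have := cond_centered_integral cYmu; under eq_integral do rewrite EFinB.
  rewrite integralB//.
  by move/eqP; rewrite sube_eq ?add0e ?integrable_fin_num ?fin_num_adde_defr// => /eqP.
apply: ae_eq_integral => //.
- by apply/measurable_EFinP; exact: measurableT_comp.
- apply/measurable_EFinP; apply: measurable_funM; first exact: measurableT_comp.
  by apply: measurable_funV; exact: measurableT_comp.
- by apply: filterS ratioE => w /= -> _.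
Qed.
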